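(* Let $A=\mathrm{IDD}(K^0_\infty,2,0)$ be the complex algebra with basis $e_0,e_1,e_2,\ldots$ and bilinear multiplication $e_i\diamond e_j=i(i-1)e_{i+j-2}$ (read as $0$ when $i\in\{0,1\}$). Then the space of derivations of $A$ is $$\mathfrak{Der}(A)=\langle\varphi,\phi\rangle,\qquad \varphi(e_i)=(i-2)e_i,\quad \phi(e_i)=i\,e_{i-1}\quad(i\ge0),$$ with $\phi(e_0)=0$.
   Context: A derivation of an algebra $(A,\diamond)$ is a linear map $D:A\to A$ with $D(a\diamond b)=D(a)\diamond b+a\diamond D(b)$ for all $a,b\in A$. $\langle S\rangle$ denotes the linear span of $S$ over $\mathbb C$. *)

(* Defs.v *)
From HB Require Import structures.
From mathcomp Require Import all_boot all_algebra complex.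
From mathcomp Require Import classical_sets functions reals.

Set Implicit Arguments.
Unset Strict Implicit.
Unset Printing Implicit Defensive.

Import GRing.Theory.
Local Open Scope classical_set_scope.
Local Open Scope ring_scope.

Definition lspan (K : nzRingType) (V : lmodType K) (S : set V) : set V :=
  [set v | exists (n : nat) (c : 'I_n -> K) (s : 'I_n -> V),
     (forall i, S (s i)) /\ v = \sum_(i < n) c i *: s i].

(* The maps A -> A form a K-module pointwise, so spans of sets of derivations
   make sense. *)
Definition Der (K : nzRingType) (A : lmodType K) (op : A -> A -> A) :
    set (A -> A) :=
  [set D | linear D /\ forall a b, D (op a b) = op (D a) b + op a (D b)].

(* The space with basis e_0, e_1, ... is modelled by {poly K}, with e_i = 'X^i.
   Only its vector space structure matters: the product of A is idd_mul, not
   the product of polynomials. *)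
Definition e (K : nzRingType) (i : nat) : {poly K} := 'X^i.
Arguments e {K} i.

(* The linear map sending e_i to f i. *)
Definition linext (K : nzRingType) (V : lmodType K) (f : nat -> V)
    (p : {poly K}) : V :=
  \sum_(i < size p) p`_i *: f i.

(* Subtraction in nat is truncated, but for i <= 1 the coefficient is 0. *)
Definition idd_mul (K : comNzRingType) (p q : {poly K}) : {poly K} :=
  \sum_(i < size p) \sum_(j < size q)
    (p`_i * q`_j) *: ((i * (i - 1))%N%:R *: e (i + j - 2)).

Definition varphi (K : nzRingType) : {poly K} -> {poly K} :=
  linext (fun i => (i%:R - 2%:R) *: e i).
Arguments varphi {K}.

Definition phi (K : nzRingType) : {poly K} -> {poly K} :=
  linext (fun i => i%:R *: e (i - 1)).
Arguments phi {K}.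

Lemma linext_widen (K : nzRingType) (V : lmodType K) (f : nat -> V)
    (p : {poly K}) (n : nat) :
  (size p <= n)%N -> linext f p = \sum_(i < n) p`_i *: f i.
Proof.
move=> le_pn; rewrite /linext (big_ord_widen n (fun i => p`_i *: f i) le_pn).
rewrite [RHS](bigID (fun i : 'I_n => (i < size p)%N)) /= [X in _ + X]big1 ?addr0 //.
by move=> i; rewrite -leqNgt => le_pi; rewrite nth_default ?scale0r.
Qed.

Lemma linext_linear (K : nzRingType) (V : lmodType K) (f : nat -> V) :
  linear (linext f : {poly K} -> V).
Proof.
move=> a p q; pose n := maxn (size (a *: p + q)) (maxn (size p) (size q)).
rewrite !(@linext_widen _ _ f _ n) ?leq_max ?leqnn ?orbT //.
rewrite scaler_sumr -big_split /=; apply: eq_bigr => i _.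
by rewrite coefD coefZ scalerDl scalerA.
Qed.

Lemma linext_e (K : nzRingType) (V : lmodType K) (f : nat -> V) (i : nat) :
  linext f (e i : {poly K}) = f i.
Proof.
rewrite /linext size_polyXn big_ord_recr /= coefXn eqxx scale1r big1 ?add0r //.
by move=> j _; rewrite coefXn ltn_eqF ?scale0r.
Qed.

Lemma e_basis (K : nzRingType) (p : {poly K}) (n : nat) (c : 'I_n -> K) :
  p = \sum_(i < size p) p`_i *: e i
  /\ (\sum_(i < n) c i *: (e i : {poly K}) = 0 -> forall i, c i = 0).
Proof.
split=> [|c0 i]; first by rewrite -[LHS]coefK poly_def.
have := congr1 (fun q : {poly K} => q`_i) c0; rewrite coef0 coef_sum.
rewrite (bigD1 i) //= big1 => [|j ne_ji]; rewrite coefZ coefXn.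
  by rewrite eqxx mulr1 addr0.
by rewrite eq_sym (inj_eq val_inj) (negPf ne_ji) mulr0.
Qed.

Lemma idd_mulE (K : comNzRingType) (p q : {poly K}) :
  idd_mul p q =
  linext (fun i => linext (fun j => (i * (i - 1))%N%:R *: e (i + j - 2)) q) p.
Proof.
rewrite /idd_mul /linext; apply: eq_bigr => i _.
by rewrite scaler_sumr; apply: eq_bigr => j _; rewrite !scalerA.
Qed.

Lemma idd_mul_e (K : comNzRingType) (i j : nat) :
  idd_mul (e i : {poly K}) (e j) = (i * (i - 1))%N%:R *: e (i + j - 2).
Proof. by rewrite idd_mulE !linext_e. Qed.

Lemma idd_mul_linearl (K : comNzRingType) (q : {poly K}) :
  linear (fun p => idd_mul p q).
Proof. by move=> a p p'; rewrite !idd_mulE; apply: linext_linear. Qed.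

Lemma idd_mul_linearr (K : comNzRingType) (p : {poly K}) : linear (idd_mul p).
Proof.
move=> a q q'; rewrite !idd_mulE.
pose f (r : {poly K}) i :=
  linext (fun j => (i * (i - 1))%N%:R *: (e (i + j - 2) : {poly K})) r.
have fD i : f (a *: q + q') i = a *: f q i + f q' i by apply: linext_linear.
change (linext (f (a *: q + q')) p = a *: linext (f q) p + linext (f q') p).
rewrite /linext scaler_sumr -big_split; apply: eq_bigr => i _ /=.
by rewrite fD scalerDr !scalerA mulrC.
Qed.

Lemma varphi_e (K : nzRingType) (i : nat) :
  varphi (e i : {poly K}) = (i%:R - 2%:R) *: e i.
Proof. exact: linext_e. Qed.

Lemma phi_e (K : nzRingType) (i : nat) :
  phi (e i : {poly K}) = i%:R *: e (i - 1).
Proof. exact: linext_e. Qed.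

(* Main.v *)
Require Import Defs.
From HB Require Import structures.
From mathcomp Require Import all_boot all_algebra complex.
From mathcomp Require Import classical_sets functions reals.
From mathcomp Require Import boolp ring.

(** Identify e_i with X^i.  The product of A is then p <> q = p'' q, the map
    phi is d/dX and varphi is X d/dX - 2, so that everything happens in the
    polynomial ring.  That phi and varphi are derivations is the Leibniz rule
    applied to p'' q, together with (X p')'' = X p''' + 2 p''.

    Conversely let D be a derivation and g = D 1.  Taking q = 1 in
    D (p'' q) = (D p)'' q + p'' D q gives (D p)'' = D (p'') - p'' g, and
    substituting this back gives D (r q) = D r q + r D q - r q g for every
    second derivative r.  Over a field of characteristic 0, r = X is one
    ([Der_mulX]), and induction on n then gives D X^n = n X^(n-1) f + X^n g with
    f = D X - X g ([Der_Xn]).  So D is the differential operator f d/dX + g.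

    It remains to bound degrees.  Since X^k <> q is 0, 0 and 2 q for
    k = 0, 1, 2, the polynomials D 1, D X and D X^2 have zero second derivative
    ([Der_deriv2_eq0]), hence degree at most 1.  With D X = u + v X, comparing
    the coefficients of X^3 and X^2 in D X^2 = 2 X D X - X^2 g forces g = 2 v,
    so f = u - v X and D = u phi - v varphi. *)

Set Implicit Arguments.
Unset Strict Implicit.
Unset Printing Implicit Defensive.

Import GRing.Theory Num.Theory.
Local Open Scope classical_set_scope.
Local Open Scope ring_scope.

(** * Linear maps on polynomials and linear spans *)

Lemma linear_eq0 (K : nzRingType) (V W : lmodType K) (f : V -> W) :
  linear f -> f 0 = 0.
Proof. by move=> /(_ (-1) 0 0); rewrite scaler0 addr0 scaleN1r addNr. Qed.

(** Two linear maps that agree on all e_i are equal: rewriting both with this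
    lemma reduces an identity between them to the basis. *)
Lemma linear_linextE (K : nzRingType) (V : lmodType K) (D : {poly K} -> V) :
  linear D -> D =1 linext (fun i => D (e i)).
Proof.
move=> linD p.
pose L : {linear {poly K} -> V} :=
  HB.pack D (GRing.isLinear.Build K {poly K} V *:%R D linD).
rewrite -[LHS]/(L p) -[p in L p]coefK poly_def linear_sum.
by apply: eq_bigr => i _; rewrite linearZ.
Qed.

Lemma linext_eq (K : nzRingType) (V : lmodType K) (f g : nat -> V) :
  f =1 g -> linext f =1 (linext g : {poly K} -> V).
Proof. by move=> fg p; apply: eq_bigr => i _; rewrite fg. Qed.

Lemma lspan_sub (K : nzRingType) (V : lmodType K) (S M : set V) :
  M 0 -> (forall a v w, M v -> M w -> M (a *: v + w)) ->
  S `<=` M -> lspan S `<=` M.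
Proof.
move=> M0 Mlin SM _ [n [c [s [Ss ->]]]].
elim/big_rec: _ => // i v _ Mv.
by apply: Mlin => //; apply: SM.
Qed.

Lemma lspan2 (K : nzRingType) (V : lmodType K) (v w : V) (a b : K) :
  lspan [set v; w] (a *: v + b *: w).
Proof.
exists 2, (fun i => if i == 0 then a else b), (fun i => if i == 0 then v else w).
split=> [i|]; last by rewrite !big_ord_recl big_ord0 addr0.
by case: ifP => _; [left | right].
Qed.

(** * The algebra in terms of formal derivatives *)

Lemma derivXn_e (K : nzRingType) (i : nat) :
  (e i : {poly K})^`() = i%:R *: e (i - 1).
Proof. by rewrite /e derivXn scaler_nat subn1. Qed.

Lemma idd_mul_deriv (K : comNzRingType) (p q : {poly K}) :
  idd_mul p q = p^`()^`() * q.
Proof.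
have lin1 : linear (fun p : {poly K} => p^`()^`() * q).
  by move=> a r s; rewrite !derivD !derivZ mulrDl scalerAl.
rewrite idd_mulE (linear_linextE lin1 p); apply: linext_eq => i.
have lin2 : linear (fun q : {poly K} => (e i)^`()^`() * q).
  by move=> a r s; rewrite mulrDr scalerAr.
rewrite (linear_linextE lin2 q); apply: linext_eq => j.
rewrite derivXn_e derivZ derivXn_e scalerA -natrM -scalerAl /e -exprD.
(* The exponents i - 1 - 1 + j and i + j - 2 can only differ when i <= 1,
   and then the coefficient i (i - 1) is 0. *)
case: i {lin1 lin2} => [|[|i]]; rewrite ?mul0n ?muln0 ?scale0r //.
by rewrite !subSS !subn0.
Qed.

Lemma phi_deriv (K : nzRingType) (p : {poly K}) : phi p = p^`().
Proof.
have linP : linear (fun p : {poly K} => p^`()).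
  by move=> a r s; rewrite derivD derivZ.
rewrite (linear_linextE linP p); apply: linext_eq => i.
by rewrite derivXn_e.
Qed.

Lemma varphi_deriv (K : comNzRingType) (p : {poly K}) :
  varphi p = 'X * p^`() - 2%:R *: p.
Proof.
have linP : linear (fun p : {poly K} => 'X * p^`() - 2%:R *: p).
  by move=> a r s; rewrite derivD derivZ -!mul_polyC; ring.
rewrite (linear_linextE linP p); apply: linext_eq => i.
rewrite derivXn_e scalerBl -scalerAr /e -exprS.
by case: i => [|i]; rewrite ?scale0r // subn1.
Qed.

(** * The maps phi and varphi are derivations *)

Section DerSubspace.

Variables (K : comNzRingType) (A : lmodType K) (op : A -> A -> A).
Hypotheses (opl : forall b, linear (op^~ b)) (opr : forall a, linear (op a)).

Lemma Der0 : Der op 0.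
Proof.
split=> [a v w|a b]; first by rewrite scaler0 addr0.
by rewrite (linear_eq0 (opl b)) (linear_eq0 (opr a)) addr0.
Qed.

Lemma Der_linear_closed (c : K) (D E : A -> A) :
  Der op D -> Der op E -> Der op (c *: D + E).
Proof.
move=> [linD derD] [linE derE].
have cDE x : (c *: D + E) x = c *: D x + E x by [].
split=> [a v w|a b]; rewrite !cDE.
  by rewrite linD linE !scalerDr !scalerA mulrC addrACA.
by rewrite derD derE opl opr scalerDr addrACA.
Qed.

End DerSubspace.

Lemma Der_phi (K : comNzRingType) : Der (@idd_mul K) phi.
Proof.
split=> [|p q]; first exact: linext_linear.
by rewrite !idd_mul_deriv !phi_deriv derivM.
Qed.

(** Since (X p')'' = X p''' + 2 p'', the term -2 p in varphi p is what makes
    X d/dX compatible with the two derivatives in the product. *)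
Lemma Der_varphi (K : comNzRingType) : Der (@idd_mul K) varphi.
Proof.
split=> [|p q]; first exact: linext_linear.
rewrite !idd_mul_deriv !varphi_deriv !(derivM, derivB, derivD, derivX, derivZ).
rewrite -!mul_polyC !(derivM, derivB, derivD, derivX, derivC) polyC_natr.
by ring.
Qed.

Lemma lspan_sub_Der (K : comNzRingType) :
  lspan [set varphi; phi] `<=` Der (@idd_mul K).
Proof.
apply: lspan_sub => [|c D E|D [] ->].
- exact: Der0 (@idd_mul_linearl K) (@idd_mul_linearr K).
- exact: Der_linear_closed (@idd_mul_linearl K) (@idd_mul_linearr K) c D E.
- exact: Der_varphi.
- exact: Der_phi.
Qed.

(** * Every derivation is a combination of phi and varphi *)

Section Derivation.

Variables (K : fieldType) (D : {poly K} -> {poly K}).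
Hypotheses (charK : [pchar K] =i pred0) (derD : Der (@idd_mul K) D).

Let D_deriv2 (p q : {poly K}) :
  D (p^`()^`() * q) = (D p)^`()^`() * q + p^`()^`() * D q.
Proof. by have [_ /(_ p q)] := derD; rewrite !idd_mul_deriv. Qed.

Let DZ (a : K) (p : {poly K}) : D (a *: p) = a *: D p.
Proof.
have [linD _] := derD.
by have := linD a p 0; rewrite (linear_eq0 linD) !addr0.
Qed.

(** X^k acts by left multiplication as the scalar k (k - 1) when k <= 2, and D
    commutes with scalars, so its derivative acts as 0, in particular on 1. *)
Lemma Der_deriv2_eq0 (k : nat) : (k <= 2)%N -> (D 'X^k)^`()^`() = 0.
Proof.
move=> le_k2; have := D_deriv2 'X^k 1; rewrite !mulr1.
have -> : ('X^k : {poly K})^`()^`() = (k * k.-1)%:R%:P.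
  case: k le_k2 => [|[|[|]]] // _.
  - by rewrite derivXn !mulr0n deriv0.
  - by rewrite derivXn expr0 mulr1n derivC.
  - by rewrite derivXn derivMn derivX polyC_natr.
rewrite -[in D _](mulr1 _%:P) !mul_polyC DZ => ckD1.
by apply: (addIr ((k * k.-1)%:R *: D 1)); rewrite add0r -ckD1.
Qed.

Lemma deriv2_eq0_coef (p : {poly K}) (i : nat) :
  p^`()^`() = 0 -> p`_i.+2 = 0.
Proof.
move=> /(congr1 (fun q : {poly K} => q`_i)).
rewrite coef0 !coef_deriv -mulrnA -mulr_natr => /eqP.
by rewrite mulf_eq0 ((pcharf0P K).1 charK) orbF => /eqP.
Qed.

(** Every derivation satisfies D (r q) = D r q + r D q - r q D 1 when r is a
    second derivative, and X = (X^3 / 6)''. *)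
Lemma Der_mulX (q : {poly K}) :
  D ('X * q) = D 'X * q + 'X * D q - 'X * q * D 1.
Proof.
pose p : {poly K} := 6%:R^-1 *: 'X^3.
have p2 : p^`()^`() = 'X.
  rewrite /p derivZ derivXn derivZ derivMn derivXn -mulrnA -scaler_nat.
  by rewrite scalerA mulVf ?scale1r // ((pcharf0P K).1 charK).
have := D_deriv2 p 1; rewrite p2 !mulr1 => DX.
have := D_deriv2 p q; rewrite p2 => ->.
by rewrite DX; ring.
Qed.

(** On the basis, D is the first-order operator f d/dX + g with g = D 1 and
    f = D X - X g. *)
Lemma Der_Xn (n : nat) :
  D 'X^n = (D 'X - 'X * D 1) * ('X^n)^`() + 'X^n * D 1.
Proof.
elim: n => [|n IHn]; first by rewrite expr0 derivC mulr0 add0r mul1r.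
rewrite exprS Der_mulX IHn derivM derivX.
by ring.
Qed.

(** The bounds on the degrees of D 1, D X and D X^2 leave only two free
    parameters, the coefficients u and v of D X = u + v X: the operator of
    [Der_Xn] is (u - v X) d/dX + 2 v. *)
Lemma Der_Xn_coef (n : nat) :
  D 'X^n = (((D 'X)`_0)%:P - (D 'X)`_1 *: 'X) * ('X^n)^`()
           + (2%:R * (D 'X)`_1) *: 'X^n.
Proof.
have D1_2 i : (D 1)`_i.+2 = 0 := deriv2_eq0_coef i (Der_deriv2_eq0 (isT : 0 <= 2)%N).
have DX_2 i : (D 'X)`_i.+2 = 0 := deriv2_eq0_coef i (Der_deriv2_eq0 (isT : 1 <= 2)%N).
have DX2_2 i : (D 'X^2)`_i.+2 = 0 := deriv2_eq0_coef i (Der_deriv2_eq0 (isT : 2 <= 2)%N).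
have DX2 : D 'X^2 = 'X * (D 'X *+ 2 - 'X * D 1).
  by rewrite exprS expr1 Der_mulX; ring.
(* Compare the coefficients of X^3 in DX2. *)
have D1_1 : (D 1)`_1 = 0.
  have := DX2_2 1%N; rewrite DX2 !(coefXM, coefB, coefMn) /= DX_2 mul0rn sub0r.
  by move/eqP; rewrite oppr_eq0 => /eqP.
(* Compare the coefficients of X^2 in DX2. *)
have D1_0 : (D 1)`_0 = 2%:R * (D 'X)`_1.
  have := DX2_2 0%N; rewrite DX2 !(coefXM, coefB, coefMn) /= => /eqP.
  by rewrite subr_eq0 eq_sym mulr_natl => /eqP.
have D1E : D 1 = (2%:R * (D 'X)`_1)%:P.
  by apply/polyP => -[|[|i]]; rewrite coefC.
have DXE : D 'X = ((D 'X)`_0)%:P + (D 'X)`_1 *: 'X.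
  apply/polyP => -[|[|i]]; rewrite coefD coefC coefZ coefX /=.
  - by rewrite mulr0 addr0.
  - by rewrite mulr1 add0r.
  - by rewrite DX_2 mulr0 addr0.
rewrite Der_Xn D1E {1}DXE -!mul_polyC polyCM polyC_natr.
by ring.
Qed.

Lemma Der_span : D = - (D 'X)`_1 *: varphi + (D 'X)`_0 *: phi.
Proof.
have [linD _] := derD.
have [linE _] := lspan_sub_Der (lspan2 varphi phi (- (D 'X)`_1) (D 'X)`_0).
apply/funext => p; rewrite (linear_linextE linD) (linear_linextE linE).
apply: linext_eq => n.
rewrite -[RHS]/(- (D 'X)`_1 *: varphi (e n) + (D 'X)`_0 *: phi (e n)).
rewrite phi_deriv varphi_deriv /e Der_Xn_coef -!mul_polyC polyCN polyC_natr.
by ring.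
Qed.

End Derivation.

Theorem corollary4p3 (R : realType) :
  Der (@idd_mul R[i]) = lspan [set varphi; phi].
Proof.
apply/seteqP; split=> [D derD|].
  rewrite (Der_span (@pchar_num _) derD); exact: lspan2.
exact: lspan_sub_Der.
Qed.
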